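(* For all integers $n,m\ge 0$, $$\mathcal L_a\big(x^n H_m(x;a|q)\big)=\frac{(q)_m}{2^n}\sum_{\alpha\ge0}\overline P(n,\alpha+m)\begin{bmatrix}\alpha+m\\ m\end{bmatrix}_q a^{\alpha},$$ $$\mathcal L_{a,b}\big(x^n Q_m(x;a,b|q)\big)=\frac{(q,ab)_m}{2^n}\sum_{\alpha,\beta\ge0}\overline P(n,\alpha+\beta+m)\begin{bmatrix}\alpha+\beta+m\\ \alpha,\beta,m\end{bmatrix}_q a^{\alpha}b^{\beta},$$ $$\mathcal L_{a,b,c}\big(x^n p_m(x;a,b,c|q)\big)=\frac{(q,ac,bc)_m}{2^n}\sum_{\alpha,\beta,\gamma\ge0}\overline P(n,\alpha+\beta+\gamma+m)\begin{bmatrix}\alpha+\beta+\gamma+m\\ \alpha,\beta,\gamma,m\end{bmatrix}_q a^{\alpha}b^{\beta}c^{\gamma}(ab)_{\gamma+m},$$ $$\mathcal L_{a,b,c,d}\big(x^n p_m(x;a,b,c,d|q)\big)=\frac{1}{2^n}\sum_{\alpha,\beta,\gamma,\delta\ge0}a^\alpha b^\beta c^\gamma d^\delta\,\overline P(n,\alpha+\beta+\gamma+\delta)\begin{bmatrix}\alpha+\beta+\gamma+\delta\\ \alpha,\beta,\gamma,\delta\end{bmatrix}_q\frac{(bd)_{\alpha}(cd)_{\alpha}(bc)_{\alpha+\delta}}{(abcd)_\alpha}\cdot\frac{(ab,ac,ad)_m\,(q^{\alpha};q^{-1})_m}{a^m(abcdq^{\alpha})_m}.$$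
   Context: Notation. $(z;p)_n=\prod_{i=0}^{n-1}(1-zp^i)$, $(z)_n=(z;q)_n$, $(z_1,\dots,z_k)_n=(z_1)_n\cdots(z_k)_n$; in particular $(q^\alpha;q^{-1})_m=\prod_{i=0}^{m-1}(1-q^{\alpha-i})$. The $q$-binomial is $\begin{bmatrix}n\\k\end{bmatrix}_q=\frac{(q)_n}{(q)_k(q)_{n-k}}$, and the $q$-multinomial is $\begin{bmatrix}N\\ n_1,\dots,n_k\end{bmatrix}_q=\frac{(q)_N}{(q)_{n_1}\cdots(q)_{n_k}}$ for $n_1+\dots+n_k=N$. Convention: $\binom nk=\begin{bmatrix}n\\k\end{bmatrix}_q=0$ if $k<0$, $k>n$, or $k$ is not an integer. $\overline P(n,m)=\sum_{k=m}^n\left(\binom{n}{\frac{n-k}2}-\binom{n}{\frac{n-k}2-1}\right)(-1)^{(k-m)/2}q^{\binom{(k-m)/2+1}2}\begin{bmatrix}\frac{k+m}2\\ \frac{k-m}2\end{bmatrix}_q$, where terms with $k\not\equiv n$ or $k\not\equiv m\pmod 2$ are zero. Thus $\overline P(n,m)=0$ if $m>n$ or $n\not\equiv m\pmod 2$, and all the sums in the claim are finite. Askey-Wilson polynomials: with $x=\cos\theta$, $$p_n(x;a,b,c,d|q)=\frac{(ab,ac,ad)_n}{a^n}\sum_{k=0}^n\frac{(q^{-n},abcdq^{n-1},ae^{i\theta},ae^{-i\theta})_k}{(q,ab,ac,ad)_k}q^k .$$ This is a polynomial in $x$ whose coefficients are polynomial in $a,b,c,d$ (and symmetric in $a,b,c,d$),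 so parameters may be set to $0$ (by continuity when $a=0$). Put $H_n(x;a|q)=p_n(x;a,0,0,0|q)$ (continuous big $q$-Hermite), $Q_n(x;a,b|q)=p_n(x;a,b,0,0|q)$ (Al-Salam-Chihara), $p_n(x;a,b,c|q)=p_n(x;a,b,c,0|q)$ (continuous dual $q$-Hahn). $\mathcal L_{a,b,c,d}$ is the linear functional on polynomials in $x$ with $\mathcal L_{a,b,c,d}(1)=1$ for which the polynomials $p_n(x;a,b,c,d|q)$ are orthogonal, i.e. $\mathcal L_{a,b,c,d}(p_mp_n)=0$ for $m\ne n$. Moreover $\mathcal L_a=\mathcal L_{a,0,0,0}$, $\mathcal L_{a,b}=\mathcal L_{a,b,0,0}$, $\mathcal L_{a,b,c}=\mathcal L_{a,b,c,0}$. The parameters $a,b,c,d,q$ are treated as indeterminates (equivalently, as generic numbers for which no denominator vanishes). *)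

(* Defs.v *)
From mathcomp Require Import all_boot all_order all_algebra.
From mathcomp Require Import ring.

Set Implicit Arguments.
Unset Strict Implicit.
Unset Printing Implicit Defensive.

Import Order.TTheory GRing.Theory Num.Theory.
Local Open Scope ring_scope.

(* (z; p)_n *)
Definition qpoch (F : fieldType) (p z : F) (n : nat) : F :=
  \prod_(i < n) (1 - z * p ^+ i).

Definition qbinom (F : fieldType) (q : F) (n k : nat) : F :=
  if (k <= n)%N then qpoch q q n / (qpoch q q k * qpoch q q (n - k)) else 0.

(* The q-multinomial of top entry N = n_1 + ... + n_k, where s = [:: n_1; ...; n_k]. *)
Definition qmultinom (F : fieldType) (q : F) (s : seq nat) : F :=
  qpoch q q (sumn s) / \prod_(i <- s) qpoch q q i.

(* The binomial coefficient with an integer lower entry: it vanishes for k < 0,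
   which truncated subtraction on nat would not give. *)
Definition binomz (n : nat) (k : int) : int :=
  if k is Posz j then ('C(n, j))%:Z else 0.

(* The halvings are exact because of the parity condition on k. *)
Definition Pbar (F : fieldType) (q : F) (n m : nat) : F :=
  \sum_(m <= k < n.+1 | (odd k == odd n) && (odd k == odd m))
    (binomz n (n - k)./2%:Z - binomz n ((n - k)./2%:Z - 1))%:~R
    * (-1) ^+ (k - m)./2 * q ^+ 'C((k - m)./2.+1, 2)
    * qbinom q (k + m)./2 (k - m)./2.

(* Since Pbar q n m vanishes for m > n, the sums over all naturals in which
   Pbar q n (i + ...) is a factor may be truncated to i < n.+1. *)
Lemma Pbar_eq0 (F : fieldType) (q : F) (n m : nat) : (n < m)%N -> Pbar q n m = 0.
Proof. by move=> lt_nm; rewrite /Pbar big_geq. Qed.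

(* (a e^{i theta}, a e^{-i theta})_k as a polynomial in x = cos theta, using
   (1 - u e^{i theta}) (1 - u e^{-i theta}) = 1 - 2 u x + u^2. *)
Definition awbase (F : fieldType) (q a : F) (k : nat) : {poly F} :=
  \prod_(i < k) (1 - (2 * (a * q ^+ i)) *: 'X + ((a * q ^+ i) ^+ 2)%:P).

(* Here z plays the role of e^{i theta}. *)
Lemma horner_awbase (F : fieldType) (q a z : F) (k : nat) :
  2 != 0 :> F -> z != 0 ->
  (awbase q a k).[(z + z^-1) / 2] = qpoch q (a * z) k * qpoch q (a * z^-1) k.
Proof.
move=> two_neq0 z_neq0; rewrite /awbase /qpoch horner_prod -big_split /=.
by apply: eq_bigr => i _; rewrite !hornerE /=; field; rewrite z_neq0.
Qed.

(* The Askey-Wilson polynomial p_n(x; a, b, c, d | q), for a, q and the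
   denominators (q, ab, ac, ad)_k nonzero. *)
Definition askey_wilson (F : fieldType) (q a b c d : F) (n : nat) : {poly F} :=
  (qpoch q (a * b) n * qpoch q (a * c) n * qpoch q (a * d) n / a ^+ n) *:
  \sum_(k < n.+1)
    (qpoch q (q ^- n) k * qpoch q (a * b * c * d * q ^ (n%:Z - 1)) k
     / (qpoch q q k * qpoch q (a * b) k * qpoch q (a * c) k * qpoch q (a * d) k)
     * q ^+ k) *: awbase q a k.

(* continuous big q-Hermite *)
Definition big_qhermite (F : fieldType) (q a : F) : nat -> {poly F} :=
  askey_wilson q a 0 0 0.

(* Al-Salam-Chihara *)
Definition al_salam_chihara (F : fieldType) (q a b : F) : nat -> {poly F} :=
  askey_wilson q a b 0 0.

(* continuous dual q-Hahn *)
Definition dual_qhahn (F : fieldType) (q a b c : F) : nat -> {poly F} :=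
  askey_wilson q a b c 0.

(* L is the normalized linear functional making the sequence p orthogonal; when
   size (p n) = n.+1 for all n, there is at most one such L. *)
Definition orthogonality_functional (F : fieldType) (p : nat -> {poly F})
    (L : {scalar {poly F}}) : Prop :=
  L 1 = 1 /\ forall i j : nat, i != j -> L (p i * p j) = 0.

(* No denominator vanishes. Indeterminates satisfy this: take for F a field of
   rational functions in a, b, c, d, q over a field of characteristic 0. *)
Definition generic_parameters (F : fieldType) (q a b c d : F) : Prop :=
  [/\ a != 0, q != 0, forall k : nat, q ^+ k.+1 != 1 &
      forall k : nat, [/\ a * b * q ^+ k != 1, a * c * q ^+ k != 1,
                          a * d * q ^+ k != 1 & a * b * c * d * q ^+ k != 1]].

(* Main.v *)
Require Import Defs.
From mathcomp Require Import all_boot all_order all_algebra.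
From mathcomp Require Import ring zify.

Set Implicit Arguments.
Unset Strict Implicit.
Unset Printing Implicit Defensive.

Import Order.TTheory GRing.Theory Num.Theory.
Local Open Scope ring_scope.

(** Write D_k(a,b,c) for the continuous dual q-Hahn polynomials, H_k for
    D_k(0,0,0), and w_j for the product of the 1 - 2 a q^i x + a^2 q^(2i) over
    i < j.

    The monomial (2x)^n is expanded in stages. Ballot numbers expand it in the
    Chebyshev polynomials of the second kind, these expand in the H_k, and the
    composite coefficient of H_k is exactly Pbar q n k
    ([monomial_qhermite]). Adding one parameter c to D_N(a,b,0) costs the
    coefficients [N, m] c^(N-m) (ab q^m)_(N-m) ([dqh_connection]). Adding three
    parameters in turn to H_N multiplies the q-binomials into a q-multinomial,
    and gives (2x)^n in the basis D_m(a,b,c) ([monomial_dqh]). All these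
    expansions are instances of one fact: if two sequences obey three-term
    recurrences in x, their connection coefficients are characterized by the
    recurrence that multiplication by x imposes on them ([ttr_connection]).

    On the side of the functional L, orthogonality to 1 is a triangular system
    for the numbers L(w_j); the q-Chu-Vandermonde sum identifies its solution as
    (ab, ac, ad)_j / (abcd)_j ([moment_awbase]). As x w_j is a combination of
    w_j and w_(j+1), the three-term recurrence of D_k then propagates closed
    forms for L(D_k w_j) from k = 0 upwards ([ttr_moment]).

    For four parameters, (2x)^n is expanded in D_k(b,c,d), which leaves out
    a: then L(D_k(b,c,d) w_j) is a product ([moment_dqh_omit]), and a second use
    of q-Chu-Vandermonde gives L(D_k(b,c,d) p_m) for p_m the Askey-Wilson
    polynomial. For three parameters, (2x)^n is expanded in D_k(a,b,c), and
    L(D_k p_m) vanishes unless k = m ([dual_qhahn_pairing]), so a single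
    coefficient of [monomial_dqh] survives. The formulas with one and two
    parameters are this one with c = 0 or b = c = 0. *)

(** * Three-term recurrences *)

(** At n = 0 the last term is C 0 times the constant 1 rather than a term of
    index -1; the recurrence is the usual one when C 0 = 0. *)
Fixpoint ttr (F : fieldType) (B C : nat -> F) (n : nat) : {poly F} :=
  if n is n'.+1 then
    (2 *: 'X - (B n')%:P) * ttr B C n' - C n' *: ttr B C n'.-1
  else 1.

Lemma eq_ttr (F : fieldType) (B B' C C' : nat -> F) :
  B =1 B' -> C =1 C' -> ttr B C =1 ttr B' C'.
Proof.
move=> eqB eqC n; have [k] := ubnP n; elim: k n => // k IHk [//|n] /=.
by rewrite ltnS => lt_nk; rewrite eqB eqC !IHk // (leq_ltn_trans (leq_pred _)).
Qed.

(** Multiplication by 2x - B' n acts on the row n of coefficients, through the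
    recurrence of the target sequence, in the same way as the recurrence on e
    prescribes for the row n + 1. *)
Lemma ttr_connection (F : fieldType) (B C B' C' : nat -> F)
    (e : nat -> nat -> F) :
  C 0%N = 0 -> C' 0%N = 0 -> e 0%N 0%N = 1 ->
  (forall n m, (n < m)%N -> e n m = 0) ->
  (forall n m, e n.+1 m = (if m is m'.+1 then e n m' else 0)
     + (B m - B' n) * e n m + C m.+1 * e n m.+1 - C' n * e n.-1 m) ->
  forall n, ttr B' C' n = \sum_(m < n.+1) e n m *: ttr B C m.
Proof.
move=> C0 C'0 e00 e_triangular e_rec.
suff wide_sum n M : (n < M)%N -> ttr B' C' n = \sum_(m < M) e n m *: ttr B C m.
  by move=> n; apply: wide_sum.
have [k] := ubnP n; elim: k n M => // k IHk [|n] M /=.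
  case: M => // M _ _; rewrite big_ord_recl e00 scale1r big1 ?addr0 // => i _.
  by rewrite e_triangular ?scale0r.
rewrite ltnS => lt_nk lt_nM; case: M lt_nM => // M; rewrite ltnS => lt_nM.
rewrite (IHk n M.+1) ?(IHk n.-1 M.+1) ?(leq_ltn_trans (leq_pred n)) //; try lia.
under [RHS]eq_bigr => m _ do rewrite e_rec scalerBl !scalerDl.
rewrite sumrB !big_split /=; congr (_ - _); last first.
  by rewrite scaler_sumr; apply: eq_bigr => m _; rewrite scalerA.
(* multiplication by 2X - B' n raises or lowers the index by one; the two end
   terms lost in the shifts carry e n M and e n M.+1, which vanish *)
have shift_up : \sum_(m < M.+1) (if val m is m'.+1 then e n m' else 0) *: ttr B C m
    = \sum_(m < M.+1) e n m *: ttr B C m.+1.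
  rewrite big_ord_recl scale0r add0r [RHS]big_ord_recr /= e_triangular //.
  by rewrite scale0r addr0.
have shift_down : \sum_(m < M.+1) (C m.+1 * e n m.+1) *: ttr B C m
    = \sum_(m < M.+1) (C m * e n m) *: ttr B C m.-1.
  rewrite big_ord_recr /= [in RHS]big_ord_recl /= C0 e_triangular; last by lia.
  by rewrite mul0r mulr0 !scale0r addr0 add0r.
rewrite shift_up shift_down mulr_sumr -!big_split /=; apply: eq_bigr => m _.
rewrite -!mul_polyC polyCM polyCB; move: (ttr _ _ m.-1) (ttr _ _ m) => P1 P0.
rewrite polyCM; ring.
Qed.

Lemma parity_split n m : (m <= n)%N && (odd m == odd n) ->
  exists j, n = (m + j.*2)%N.
Proof.
by case/andP=> le_mn /eqP eq_odd; exists ((n - m)./2); lia.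
Qed.

(** Connection coefficients between two sequences of polynomials of alternating
    parity: they vanish unless n = m + 2 j, and are then indexed by m and j. *)
Definition parity_coef (F : fieldType) (c : nat -> nat -> F) (n m : nat) : F :=
  if (m <= n)%N && (odd m == odd n) then c m (n - m)./2 else 0.

Lemma parity_coefE (F : fieldType) (c : nat -> nat -> F) m j :
  parity_coef c (m + j.*2) m = c m j.
Proof.
rewrite /parity_coef leq_addr oddD odd_double addbF eqxx /=.
by rewrite addKn doubleK.
Qed.

Lemma parity_coef_gt (F : fieldType) (c : nat -> nat -> F) n m :
  (n < m)%N -> parity_coef c n m = 0.
Proof. by move=> lt_nm; rewrite /parity_coef leqNgt lt_nm. Qed.

Lemma parity_ttr_connection (F : fieldType) (C C' : nat -> F)
    (c : nat -> nat -> F) :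
  C 0%N = 0 -> C' 0%N = 0 -> c 0%N 0%N = 1 ->
  (forall m, c m.+1 0%N = c m 0%N) ->
  (forall m j, c m.+1 j.+1 = c m j.+1 + C m.+2 * c m.+2 j
                             - C' (m + j.+1.*2)%N * c m.+1 j) ->
  (forall j, c 0%N j.+1 = C 1%N * c 1%N j - C' j.*2.+1 * c 0%N j) ->
  forall n, ttr (fun=> 0) C' n
    = \sum_(m < n.+1) parity_coef c n m *: ttr (fun=> 0) C m.
Proof.
move=> C0 C'0 c00 cS0 cSS c0S; apply: ttr_connection => //.
  by move=> n m; apply: parity_coef_gt.
move=> n m; rewrite subr0 mul0r addr0.
have [/parity_split[j]|Nnm] := boolP ((m <= n.+1)%N && (odd m == odd n.+1)).
  case: m => [|m] defn; last first.
    have{defn} ->: n = (m + j.*2)%N by lia.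
    rewrite -addSn !parity_coefE; case: j => [|j].
      rewrite addn0 cS0 (parity_coef_gt c (leqnSn m.+1)) mulr0 addr0.
      case: m => [|m] /=; first by rewrite C'0 mul0r subr0.
      by rewrite (parity_coef_gt c (leqnSn m.+1)) mulr0 subr0.
    have -> : parity_coef c (m + j.+1.*2) m.+2 = c m.+2 j.
      by rewrite doubleS !addnS -!addSn parity_coefE.
    have -> : parity_coef c (m + j.+1.*2).-1 m.+1 = c m.+1 j.
      by rewrite doubleS !addnS /= -!addSn parity_coefE.
    by rewrite cSS.
  case: j defn => // j defn; have{defn} ->: n = (1 + j.*2)%N by lia.
  have -> : (1 + j.*2).+1 = (0 + j.+1.*2)%N by lia.
  rewrite add0r !parity_coefE /= -[X in _ - _ * parity_coef _ X _]add0n.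
  by rewrite parity_coefE c0S add1n.
have -> : parity_coef c n.+1 m = 0 by rewrite /parity_coef (negbTE Nnm).
have -> : parity_coef c n m.+1 = 0.
  by rewrite /parity_coef; case: ifP => //; lia.
have -> : C' n * parity_coef c n.-1 m = 0.
  case: n Nnm => [|n] Nnm; first by rewrite C'0 mul0r.
  by rewrite /parity_coef; case: ifP => //=; rewrite ?mulr0 //; lia.
rewrite mulr0 subr0 addr0; case: m Nnm => // m Nnm.
by rewrite /parity_coef; case: ifP => //; lia.
Qed.

(** * Shifted factorials and q-binomial coefficients *)

Lemma qpochS (F : fieldType) (p z : F) n :
  qpoch p z n.+1 = qpoch p z n * (1 - z * p ^+ n).
Proof. by rewrite /qpoch big_ord_recr. Qed.

Lemma qpoch0 (F : fieldType) (p z : F) : qpoch p z 0 = 1.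
Proof. by rewrite /qpoch big_ord0. Qed.

Lemma qpochD (F : fieldType) (p z : F) m n :
  qpoch p z (m + n) = qpoch p z m * qpoch p (z * p ^+ m) n.
Proof.
elim: n => [|n IHn]; first by rewrite addn0 qpoch0 mulr1.
by rewrite addnS !qpochS IHn exprD !mulrA.
Qed.

Lemma qpochSl (F : fieldType) (p z : F) n :
  qpoch p z n.+1 = (1 - z) * qpoch p (z * p) n.
Proof. by rewrite -add1n qpochD qpochS qpoch0 mul1r mulr1. Qed.

Lemma qpoch_neq0 (F : fieldType) (p z : F) n :
  (forall k, z * p ^+ k != 1) -> qpoch p z n != 0.
Proof.
move=> zpN1; apply/prodf_neq0 => i _.
by rewrite subr_eq0 eq_sym.
Qed.

Lemma qpoch_z0 (F : fieldType) (p : F) n : qpoch p 0 n = 1.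
Proof. by rewrite /qpoch big1 // => i _; rewrite mul0r subr0. Qed.

Lemma qpoch_qq_neq0 (F : fieldType) (q : F) n :
  (forall k, q ^+ k.+1 != 1) -> qpoch q q n != 0.
Proof. by move=> qN1; apply: qpoch_neq0 => k; rewrite -exprS. Qed.

Lemma qbinomDl (F : fieldType) (q : F) m n :
  qbinom q (m + n) n = qpoch q q (m + n) / (qpoch q q n * qpoch q q m).
Proof. by rewrite /qbinom leq_addl addnK. Qed.

Lemma qbinomDr (F : fieldType) (q : F) m n :
  qbinom q (m + n) m = qpoch q q (m + n) / (qpoch q q m * qpoch q q n).
Proof. by rewrite /qbinom leq_addr addKn. Qed.

Lemma qbinom_gt (F : fieldType) (q : F) m n : (n < m)%N -> qbinom q n m = 0.
Proof. by move=> lt_nm; rewrite /qbinom leqNgt lt_nm. Qed.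

Lemma qbinom_diag (F : fieldType) (q : F) n :
  (forall k, q ^+ k.+1 != 1) -> qbinom q n n = 1.
Proof.
by move=> qN1; rewrite /qbinom leqnn subnn qpoch0 mulr1 divff ?qpoch_qq_neq0.
Qed.

(** * Monomials in terms of the continuous q-Hermite polynomials *)

Lemma ttr_monomial (F : fieldType) n :
  ttr (fun=> 0) (fun=> 0) n = 2 ^+ n *: 'X^n :> {poly F}.
Proof.
elim: n => [|n IHn] /=; first by rewrite scale1r.
by rewrite scale0r !subr0 IHn -scalerAr -scalerAl scalerA -exprSr -exprS.
Qed.

(** The coefficient of U_k in (2x)^(k + 2 j), U_k being the Chebyshev polynomial
    of the second kind. *)
Definition ballot (k j : nat) : int :=
  binomz (k + j.*2) j%:Z - binomz (k + j.*2) (j%:Z - 1).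

Lemma binomz_pred n j :
  binomz n (j%:Z - 1) = if j is j'.+1 then ('C(n, j'))%:Z else 0.
Proof. by case: j => [|j] //; rewrite -addn1 PoszD addrK. Qed.

(** Since 2x U_k = U_(k+1) + U_(k-1), the coefficients count lattice paths that
    stay nonnegative. *)
Lemma monomial_chebyshev (F : fieldType) n :
  2 ^+ n *: 'X^n = \sum_(k < n.+1) parity_coef (fun k j => (ballot k j)%:~R) n k
    *: ttr (fun=> 0) (fun k => (k != 0%N)%:R) k :> {poly F}.
Proof.
rewrite -ttr_monomial; apply: parity_ttr_connection => //.
- by move=> m; rewrite /ballot !binomz_pred /= !bin0.
- move=> m j; rewrite /= mul1r mul0r subr0 -intrD; congr (_%:~R).
  rewrite /ballot !binomz_pred /= !doubleS !addnS !addSn !binS.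
  by case: j => [|j]; rewrite ?bin0 ?binS ?PoszD; lia.
move=> j; rewrite /= mul1r mul0r subr0; congr (_%:~R).
rewrite /ballot !binomz_pred /= doubleS !add0n add1n (binS _.+1 j).
(* height 0 is reached from height 1 only; the symmetry of the two central
   binomials makes up for the missing neighbour *)
have -> : 'C(j.*2.+1, j.+1) = 'C(j.*2.+1, j).
  by rewrite -bin_sub; [congr ('C(_, _)); lia | lia].
by case: j => [|j]; rewrite ?bin0 ?(binS j.+1.*2.+1 j) ?PoszD; lia.
Qed.

(** The recurrence with C_m = 1 - q^m is that of the continuous q-Hermite
    polynomials, and the Chebyshev polynomials are the case q = 0. At
    k = m + 2 j the required recurrence on the coefficients is a form of the
    q-Pascal rule. *)
Lemma chebyshev_qhermite (F : fieldType) (q : F) k :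
  (forall k, q ^+ k.+1 != 1) ->
  ttr (fun=> 0) (fun k => (k != 0%N)%:R) k =
  \sum_(m < k.+1)
    parity_coef (fun m j => (-1) ^+ j * q ^+ 'C(j.+1, 2) * qbinom q (m + j) j) k m
    *: ttr (fun=> 0) (fun m => 1 - q ^+ m) m.
Proof.
move=> qN1; have pq_neq0 n : qpoch q q n != 0 by apply: qpoch_qq_neq0.
have q1 n : 1 - q * q ^+ n != 0 by rewrite subr_eq0 eq_sym -exprS.
apply: parity_ttr_connection => //.
- by rewrite expr0 subrr.
- by rewrite /qbinom qpoch0 !mul1r invr1.
- move=> m; rewrite !qbinomDl !addn0 qpoch0 !mul1r !divff ?mulr1 //.
- move=> m j; rewrite doubleS !addnS /= mul1r -!addnS !qbinomDl.
  rewrite !(addSn, addnS) !qpochS.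
  rewrite !(binS _.+1 1) !bin1 !exprD !exprS.
  have := q1 (m + j)%N; have := q1 (m + j).+1; have := q1 j; have := q1 j.+1.
  have := q1 m; have := q1 m.+1.
  rewrite !exprS !exprD => h1 h2 h3 h4 h5 h6; field.
  by rewrite !pq_neq0 /=; do ?[apply/andP; split]; rewrite // mulrA in h1 h3 h5 *.
move=> j; rewrite /= mul1r !qbinomDl !(addSn, addnS, add0n, addn0) !qpochS !qpoch0.
rewrite !(binS _.+1 1) !bin1 !exprD !exprS expr0.
have := q1 j; have := q1 0%N.
rewrite expr0 => h1 h2; field.
by rewrite !pq_neq0 /= mulr1 in h1 *; rewrite h1.
Qed.

Lemma sum_ord_widen (V : nmodType) (f : nat -> V) m n :
  (m <= n)%N -> (forall i, (m <= i)%N -> f i = 0) ->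
  \sum_(i < m) f i = \sum_(i < n) f i.
Proof.
move=> le_mn f0; rewrite (big_ord_widen n) // big_mkcond.
by apply: eq_bigr => i _; case: ltnP => // /f0.
Qed.

Lemma PbarE (F : fieldType) (q : F) n m :
  Pbar q n m = \sum_(k < n.+1) parity_coef (fun k j => (ballot k j)%:~R) n k
    * parity_coef (fun m j => (-1) ^+ j * q ^+ 'C(j.+1, 2) * qbinom q (m + j) j)
        k m.
Proof.
rewrite /Pbar big_geq_mkord big_mkcond; apply: eq_bigr => -[k lt_kn] _ /=.
have [/parity_split[i defn]|Nkn] := boolP ((k <= n)%N && (odd k == odd n)); last first.
  rewrite /parity_coef (negbTE Nkn) mul0r; case: ifP => //; lia.
have [/parity_split[j defk]|Nmk] := boolP ((m <= k)%N && (odd m == odd k)); last first.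
  by rewrite /parity_coef (negbTE Nmk) mulr0; case: ifP => //; lia.
have -> : parity_coef (fun k j => (ballot k j)%:~R) n k = (ballot k i)%:~R :> F.
  by rewrite defn parity_coefE.
set c := (fun m j => _ * _); have -> : parity_coef c k m = c m j.
  by rewrite defk parity_coefE.
rewrite ifT /c; last by lia.
have -> : (n - k)./2 = i by lia.
have -> : (k - m)./2 = j by lia.
have -> : (k + m)./2 = (m + j)%N by lia.
by rewrite /ballot -defn !mulrA.
Qed.

Lemma monomial_qhermite (F : fieldType) (q : F) n :
  (forall k, q ^+ k.+1 != 1) ->
  2 ^+ n *: 'X^n
  = \sum_(m < n.+1) Pbar q n m *: ttr (fun=> 0) (fun m => 1 - q ^+ m) m.
Proof.
move=> qN1; rewrite monomial_chebyshev.
under [RHS]eq_bigr => m _ do rewrite PbarE scaler_suml.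
rewrite exchange_big; apply: eq_bigr => k _ /=.
rewrite (chebyshev_qhermite _ qN1) scaler_sumr.
set c := (X in parity_coef X k); set P := ttr _ _.
rewrite (@sum_ord_widen _ (fun m => _ *: (parity_coef c k m *: P m)) _ n.+1) //.
  by apply: eq_bigr => m _; rewrite scalerA.
by move=> m lt_km; rewrite (parity_coef_gt c lt_km) scale0r scaler0.
Qed.

(** * Adding parameters one at a time *)

(** The continuous dual q-Hahn polynomials by their three-term recurrence. Its
    coefficients are polynomial in a, b, c, so that, unlike in the explicit
    sum, a may be 0, and the symmetry in a, b, c is apparent. *)
Definition dqh (F : fieldType) (q a b c : F) : nat -> {poly F} :=
  ttr (fun n => (a + b + c) * q ^+ n
                + a * b * c * (q ^+ n / q) * (1 - q ^+ n - q ^+ n * q))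
      (fun n => (1 - q ^+ n) * (1 - a * b * (q ^+ n / q))
                * (1 - a * c * (q ^+ n / q)) * (1 - b * c * (q ^+ n / q))).

Lemma dqhCA (F : fieldType) (q a b c : F) : dqh q a b c =1 dqh q b a c.
Proof. by apply: eq_ttr => n; ring. Qed.

Lemma dqhAC (F : fieldType) (q a b c : F) : dqh q a b c =1 dqh q a c b.
Proof. by apply: eq_ttr => n; ring. Qed.

(** For ab = 0 this is Euler's series for the inverse of the infinite product
    (ct), applied to generating functions. In general the recurrence required
    by [ttr_connection] becomes a rational identity once the neighbours of a
    coefficient are written as multiples of it. *)
Lemma dqh_connection (F : fieldType) (q a b c : F) (q0 : q != 0)
    (qN1 : forall k, q ^+ k.+1 != 1) n :
  dqh q a b 0 n = \sum_(m < n.+1) (qbinom q n m * c ^+ (n - m)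
     * qpoch q (a * b * q ^+ m) (n - m)) *: dqh q a b c m.
Proof.
have pq_neq0 k : qpoch q q k != 0 by apply: qpoch_qq_neq0.
have q1 k : 1 - q * q ^+ k != 0 by rewrite subr_eq0 eq_sym -exprS.
set e := fun n m => qbinom q n m * c ^+ (n - m)
                    * qpoch q (a * b * q ^+ m) (n - m).
have e_gt k m : (k < m)%N -> e k m = 0 by move=> lt; rewrite /e qbinom_gt ?mul0r.
have eE m j : e (m + j)%N m = qpoch q q (m + j) / (qpoch q q m * qpoch q q j)
    * c ^+ j * qpoch q (a * b * q ^+ m) j.
  by rewrite /e qbinomDr addKn.
have e_diag m : e m m = 1.
  by have := eE m 0%N; rewrite addn0 qpoch0 => ->; rewrite !mulr1 divff ?qpoch0 ?mulr1.
apply: (ttr_connection (e := e)) => // [||k m]; rewrite ?expr0 ?subrr ?mul0r //.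
have [lt_km|le_mk] := ltnP k m.
  rewrite (e_gt k m) // (e_gt k m.+1) 1?ltnW // (e_gt k.-1 m); last by lia.
  rewrite !mulr0 subr0 !addr0; case: m lt_km => // m.
  rewrite ltnS leq_eqVlt => /orP[/eqP <-|lt_km]; first by rewrite !e_diag.
  by rewrite !e_gt.
have [j ->] : exists j, k = (m + j)%N by exists (k - m)%N; lia.
have -> : (if m is m'.+1 then e (m + j)%N m' else 0)
   = (1 - q ^+ m) * (1 - a * b * (q ^+ m / q)) / (1 - q * q ^+ j)
     * c * e (m + j)%N m.
  case: m {le_mk} => [|m]; first by rewrite expr0 subrr !mul0r.
  have := eE m j.+1; have := eE m.+1 j; rewrite addSn addnS => -> ->.
  rewrite [qpoch q q m.+1]qpochS [qpoch q q j.+1]qpochS [qpoch q (a * b * _) _]qpochSl !exprS.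
  rewrite -[a * b * _ * q]mulrA -exprSr exprS.
  by field; rewrite !(pq_neq0, q1) q0.
have -> : e (m + j).+1 m = (1 - q * q ^+ m * q ^+ j)
    * (1 - a * b * q ^+ m * q ^+ j) / (1 - q * q ^+ j) * c * e (m + j)%N m.
  rewrite -addnS !eE addnS !qpochS !exprS exprD.
  by field; rewrite !(pq_neq0, q1).
(* Separately, these two terms are multiples of c^(j-1), not of e; their
   difference gains the missing factor c, which also covers j = 0 and c = 0. *)
set C := (X in X * e _ m.+1); set C' := (X in _ - X * e (_.-1) m).
have shifts : C * e (m + j)%N m.+1 - C' * e (m + j).-1 m
    = (1 - q ^+ j) * (a * b * c * q ^+ m - a - b) * q ^+ m * e (m + j)%N m.
  case: j => [|j] in C C' le_mk *.
    rewrite addn0 e_gt // mulr0 expr0 subrr !mul0r sub0r /C' addn0.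
    case: m {C le_mk C'} => [|m]; first by rewrite expr0 subrr !mul0r oppr0.
    by rewrite e_gt // mulr0 oppr0.
  set G := qpoch q q (m + j.+1) / (qpoch q q m * qpoch q q j.+1)
           * qpoch q (a * b * q ^+ m) j.+1.
  have lowered : C * e (m + j.+1)%N m.+1
      = (1 - a * c * q ^+ m) * (1 - b * c * q ^+ m) * (1 - q * q ^+ j)
        * c ^+ j * G.
    rewrite /C /G [qpoch q (a * b * _) _]qpochSl.
    have := eE m.+1 j; rewrite addSn addnS => ->.
    rewrite [qpoch q q m.+1]qpochS [qpoch q q j.+1]qpochS !exprS.
    rewrite -[a * b * _ * q]mulrA -exprSr exprS.
    by field; rewrite !(pq_neq0, q1) q0.
  have previous : C' * e (m + j.+1).-1 m = (1 - q * q ^+ j) * c ^+ j * G.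
    rewrite /C' /G addnS /= eE !qpochS !exprS exprD.
    by field; rewrite !(pq_neq0, q1) q0.
  have -> : e (m + j.+1)%N m = c ^+ j.+1 * G by rewrite eE /G; ring.
  by rewrite lowered previous !exprS; ring.
rewrite -addrA shifts.
by rewrite !exprD; field; rewrite q1 q0.
Qed.

(** The triangle m <= k <= n becomes the square i, m <= n under k = i + m,
    because g vanishes beyond n. This is what lets all sums run over the same
    range after several changes of basis. *)
Lemma triangular_expansion (F : fieldType) (V : lmodType F)
    (g : nat -> F) (w : nat -> nat -> F) (R P : nat -> V) n :
  (forall k, (n < k)%N -> g k = 0) ->
  (forall k, R k = \sum_(m < k.+1) w k m *: P m) ->
  \sum_(k < n.+1) g k *: R k
  = \sum_(m < n.+1) (\sum_(i < n.+1) g (i + m)%N * w (i + m)%N m) *: P m.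
Proof.
move=> g0 defR.
transitivity (\sum_(k < n.+1) \sum_(m < n.+1)
                (if (m <= k)%N then g k * w k m else 0) *: P m).
  apply: eq_bigr => k _; rewrite defR scaler_sumr.
  rewrite (big_ord_widen n.+1 (fun m => g k *: (w k m *: P m))) // big_mkcond.
  by apply: eq_bigr => m _; rewrite ltnS scalerA; case: ifP; rewrite ?scale0r.
rewrite exchange_big; apply: eq_bigr => m _ /=; rewrite -scaler_suml -big_mkcond.
rewrite -(big_geq_mkord _ _ xpredT (fun k => g k * w k m)) /= -{1}[val m]add0n big_addn.
rewrite big_mkord; congr (_ *: _).
apply: (sum_ord_widen (f := fun i => g (i + m)%N * w (i + m)%N m)) => [|i le_i].
  exact: leq_subr.
by rewrite g0 ?mul0r // addnC -leq_subLR.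
Qed.

Lemma qmultinom4E (F : fieldType) (q : F) i j k l :
  qmultinom q [:: i; j; k; l]
  = qpoch q q (i + (j + (k + l)))
    / (qpoch q q i * qpoch q q j * qpoch q q k * qpoch q q l).
Proof. by rewrite /qmultinom /= !big_cons big_nil addn0 mulr1 !mulrA. Qed.

Definition dqh_coef (F : fieldType) (q a b c : F) (n m : nat) : F :=
  \sum_(i < n.+1) \sum_(j < n.+1) \sum_(k < n.+1)
    Pbar q n (i + j + k + m) * qmultinom q [:: val i; val j; val k; m]
    * a ^+ i * b ^+ j * c ^+ k * qpoch q (a * b * q ^+ m) k.

(** The three parameters are added in turn to the q-Hermite expansion; the
    factor (ab q^m)_k appears only in the last step, as the products of two
    parameters vanish in the first two. *)
Lemma monomial_dqh (F : fieldType) (q a b c : F) (q0 : q != 0)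
    (qN1 : forall k, q ^+ k.+1 != 1) n :
  2 ^+ n *: 'X^n = \sum_(m < n.+1) dqh_coef q a b c n m *: dqh q a b c m.
Proof.
have pq_neq0 k : qpoch q q k != 0 by apply: qpoch_qq_neq0.
have add_a k : dqh q 0 0 0 k = \sum_(m < k.+1)
    (qbinom q k m * a ^+ (k - m)) *: dqh q a 0 0 m.
  rewrite (dqh_connection 0 0 a) //; apply: eq_bigr => m _.
  by rewrite !mul0r qpoch_z0 mulr1 dqhAC dqhCA.
have add_b k : dqh q a 0 0 k = \sum_(m < k.+1)
    (qbinom q k m * b ^+ (k - m)) *: dqh q a b 0 m.
  rewrite (dqh_connection a 0 b) //; apply: eq_bigr => m _.
  by rewrite mulr0 mul0r qpoch_z0 mulr1 dqhAC.
rewrite (monomial_qhermite _ qN1).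
have qhermiteE : ttr (fun=> 0) (fun m => 1 - q ^+ m) =1 dqh q 0 0 0.
  by apply: eq_ttr => k; ring.
under eq_bigr => m _ do rewrite qhermiteE.
pose push w g m : F := \sum_(i < n.+1) g (i + m)%N * w (i + m)%N m.
have push0 w g : (forall k, (n < k)%N -> g k = 0) ->
    forall m, (n < m)%N -> push w g m = 0.
  by move=> g0 m lt_nm; rewrite /push big1 // => i _; rewrite g0 ?mul0r //; lia.
have g0 k : (n < k)%N -> Pbar q n k = 0 by apply: Pbar_eq0.
pose wa k m := qbinom q k m * a ^+ (k - m).
pose wb k m := qbinom q k m * b ^+ (k - m).
pose wc k m := qbinom q k m * c ^+ (k - m) * qpoch q (a * b * q ^+ m) (k - m).
rewrite (triangular_expansion (w := wa) g0 add_a).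
rewrite (triangular_expansion (g := push wa _) (w := wb) _ add_b);
  last exact: push0.
rewrite (triangular_expansion (g := push wb _) (w := wc) _
  (dqh_connection a b c q0 qN1)); last exact/push0/push0.
apply: eq_bigr => m _; congr (_ *: _).
rewrite /dqh_coef /push /wa /wb /wc; under eq_bigr => k _ do rewrite mulr_suml.
under eq_bigr => k _ do under eq_bigr => j _ do rewrite !mulr_suml.
rewrite exchange_big [RHS]exchange_big; apply: eq_bigr => j _ /=.
rewrite exchange_big; apply: eq_bigr => i _ /=; apply: eq_bigr => k _.
rewrite !addnK !qbinomDl qmultinom4E -!addnA.
by field; rewrite !pq_neq0.
Qed.

(** * The q-Chu-Vandermonde sum *)

Lemma qbinom_pascal (F : fieldType) (q : F) m j
    (qN1 : forall k, q ^+ k.+1 != 1) :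
  qbinom q m.+1 j.+1 = qbinom q m j.+1 + q ^+ (m - j) * qbinom q m j.
Proof.
have pq_neq0 k : qpoch q q k != 0 by apply: qpoch_qq_neq0.
have q1 k : 1 - q * q ^+ k != 0 by rewrite subr_eq0 eq_sym -exprS.
have [lt_mj|] := ltnP m j.
  by rewrite !qbinom_gt ?mulr0 ?addr0 // ltnW.
rewrite leq_eqVlt => /orP[/eqP ->|lt_jm].
  by rewrite [qbinom q m m.+1]qbinom_gt // subnn add0r mul1r !qbinom_diag.
have [i ->] : exists i, m = (j + i.+1)%N by exists (m - j.+1)%N; lia.
rewrite addKn qbinomDr -!addSnnS -addnS !qbinomDr addSn addnS !qpochS.
rewrite !exprS exprD.
by field; rewrite !(pq_neq0, q1).
Qed.

(** The second q-Chu-Vandermonde sum with lower parameter written u z, where u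
    is fixed: then z may be 0, and Pascal's rule turns the sum for m + 1 into the
    sums for m at z and at z q. *)
Lemma qchu_vandermonde (F : fieldType) (q : F) m u z
    (qN1 : forall k, q ^+ k.+1 != 1) :
  (forall i, u * z * q ^+ i != 1) ->
  \sum_(j < m.+1) qbinom q m j * (-1) ^+ j * q ^+ 'C(j, 2) * u ^+ j
    * (qpoch q z j / qpoch q (u * z) j)
  = qpoch q u m / qpoch q (u * z) m.
Proof.
elim: m z => [|m IHm] z uzN1.
  by rewrite big_ord1 !qpoch0 qbinom_diag // !mul1r.
have uz1 i : 1 - u * z * q ^+ i != 0 by rewrite subr_eq0 eq_sym.
set t := fun j => (-1) ^+ j * q ^+ 'C(j, 2) * u ^+ j
                  * (qpoch q z j / qpoch q (u * z) j).
have tE j k : qbinom q k j * (-1) ^+ j * q ^+ 'C(j, 2) * u ^+ j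
    * (qpoch q z j / qpoch q (u * z) j) = qbinom q k j * t j.
  by rewrite /t !mulrA.
under eq_bigr => j _ do rewrite tE.
rewrite big_ord_recl /=.
under eq_bigr => j _ do rewrite /bump add1n qbinom_pascal // mulrDl.
rewrite big_split addrA /=.
have -> : qbinom q m.+1 0 * t 0%N + \sum_(j < m.+1) qbinom q m j.+1 * t j.+1
    = \sum_(j < m.+1) qbinom q m j * t j.
  have -> : qbinom q m.+1 0 = qbinom q m 0.
    by rewrite /qbinom !subn0 qpoch0 !mul1r !divff ?qpoch_qq_neq0.
  rewrite -(big_ord_recl m.+1 (fun j => qbinom q m j * t j)) big_ord_recr /=.
  by rewrite qbinom_gt // mul0r addr0.
have -> : \sum_(j < m.+1) qbinom q m j * t j = qpoch q u m / qpoch q (u * z) m.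
  by rewrite -IHm //; apply: eq_bigr => j _; rewrite tE.
have uzqN1 i : u * (z * q) * q ^+ i != 1 by rewrite mulrA -mulrA -exprS.
have -> : \sum_(j < m.+1) q ^+ (m - j) * qbinom q m j * t j.+1
    = - (u * q ^+ m * (1 - z) / (1 - u * z))
      * (qpoch q u m / qpoch q (u * (z * q)) m).
  rewrite -IHm // mulr_sumr; apply: eq_bigr => j _.
  have -> : q ^+ m = q ^+ (m - j) * q ^+ j.
    by rewrite -exprD subnK // -ltnS.
  rewrite /t !qpochSl binS bin1 !exprD !exprS; have := uz1 0%N; rewrite mulr1 => uz1_0.
  rewrite [u * (z * q)]mulrA.
  field; rewrite uz1_0 andbT; apply: qpoch_neq0 => i.
  by rewrite -mulrA -exprS.
rewrite [qpoch q u m.+1]qpochS.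
have -> : qpoch q (u * (z * q)) m
    = qpoch q (u * z) m * (1 - u * z * q ^+ m) / (1 - u * z).
  rewrite mulrA -qpochS qpochSl; have := uz1 0%N; rewrite mulr1 => uz1_0.
  by field.
rewrite qpochS; have := uz1 0%N; rewrite mulr1 => uz1_0.
by field; rewrite uz1_0 uz1 qpoch_neq0.
Qed.

Lemma qpoch_qV (F : fieldType) (q : F) n k (q0 : q != 0)
    (qN1 : forall k, q ^+ k.+1 != 1) :
  (k <= n)%N ->
  qpoch q (q ^- n) k / qpoch q q k
  = qbinom q n k * (-1) ^+ k * q ^+ 'C(k, 2) * (q ^- n) ^+ k.
Proof.
move=> le_kn; rewrite /qbinom le_kn.
have pq_neq0 j : qpoch q q j != 0 by apply: qpoch_qq_neq0.
suff E : qpoch q (q ^- n) k * qpoch q q (n - k)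
    = (-1) ^+ k * q ^+ 'C(k, 2) * (q ^- n) ^+ k * qpoch q q n.
  apply: (mulIf (pq_neq0 (n - k)%N)); rewrite mulrAC E.
  by field; rewrite !pq_neq0.
elim: k le_kn => [|k IHk] lt_kn; first by rewrite qpoch0 subn0 !mul1r.
have := IHk (ltnW lt_kn); have -> : (n - k)%N = (n - k.+1).+1 by lia.
rewrite !qpochS -exprS => E.
have qn0 : q ^+ (n - k.+1).+1 != 0 by rewrite expf_neq0.
have qn1 : 1 - q ^+ (n - k.+1).+1 != 0 by rewrite subr_eq0 eq_sym.
rewrite binS bin1 exprD !exprS.
transitivity (- (q ^- n * q ^+ k) * (qpoch q (q ^- n) k *
    (qpoch q q (n - k.+1) * (1 - q ^+ (n - k.+1).+1)))); last by rewrite E; ring.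
have -> : q ^- n = (q ^+ k)^-1 * (q ^+ (n - k.+1).+1)^-1.
  by rewrite -invfM -exprD; congr (q ^- _); lia.
move: (q ^+ (n - k.+1).+1) qn0 qn1 => y y0 y1.
by field; rewrite y0 expf_neq0.
Qed.

Lemma qpoch_falling (F : fieldType) (q : F) s m (q0 : q != 0) :
  qpoch q (q ^+ s * q * q ^- m) m = qpoch q^-1 (q ^+ s) m.
Proof.
rewrite /qpoch (reindex_inj rev_ord_inj) /=; apply: eq_bigr => i _.
have -> : q ^+ m = q ^+ (m - i.+1) * (q * q ^+ i).
  by rewrite -exprS -exprD subnK.
by rewrite exprVn; field; rewrite q0 !expf_neq0.
Qed.

(** Every pairing with an Askey-Wilson polynomial reduces to this sum: after
    cancellation it is [qchu_vandermonde] with u = q^(s+1-m) and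
    z = abcd q^(m-1). *)
Lemma askey_wilson_coef_sum (F : fieldType) (q a b c d kappa : F) (s m : nat) :
  generic_parameters q a b c d ->
  \sum_(k < m.+1)
    (qpoch q (q ^- m) k * qpoch q (a * b * c * d * q ^ (m%:Z - 1)) k
     / (qpoch q q k * qpoch q (a * b) k * qpoch q (a * c) k * qpoch q (a * d) k)
     * q ^+ k) * (kappa * (q ^+ k) ^+ s
      * (qpoch q (a * b) k * qpoch q (a * c) k * qpoch q (a * d) k)
      / qpoch q (a * b * c * d) (k + s))
  = kappa * qpoch q^-1 (q ^+ s) m
    / (qpoch q (a * b * c * d) s * qpoch q (a * b * c * d * q ^+ s) m).
Proof.
case=> a0 q0 qN1 genN1; have pq_neq0 j : qpoch q q j != 0 by apply: qpoch_qq_neq0.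
have ab_neq0 k : qpoch q (a * b) k != 0 by apply: qpoch_neq0 => i; case: (genN1 i).
have ac_neq0 k : qpoch q (a * c) k != 0 by apply: qpoch_neq0 => i; case: (genN1 i).
have ad_neq0 k : qpoch q (a * d) k != 0 by apply: qpoch_neq0 => i; case: (genN1 i).
set e := a * b * c * d.
have eN1 i : e * q ^+ i != 1 by case: (genN1 i).
have esN1 i : e * q ^+ s * q ^+ i != 1 by rewrite -mulrA -exprD.
have es_neq0 k : qpoch q (e * q ^+ s) k != 0 by apply: qpoch_neq0.
have e_neq0 k : qpoch q e k != 0 by apply: qpoch_neq0.
have -> : q ^ (m%:Z - 1) = q ^+ m / q by rewrite expfzDr // exprN1 mulrC.
set u := q ^+ s * q * q ^- m; set z := e * (q ^+ m / q).
have uz : u * z = e * q ^+ s.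
  by rewrite /u /z; field; rewrite q0 expf_neq0.
have uzN1 i : u * z * q ^+ i != 1 by rewrite uz.
have := qchu_vandermonde m qN1 uzN1; rewrite uz qpoch_falling // => qchu.
have -> : kappa * qpoch q^-1 (q ^+ s) m / (qpoch q e s * qpoch q (e * q ^+ s) m)
    = kappa / qpoch q e s * (qpoch q^-1 (q ^+ s) m / qpoch q (e * q ^+ s) m).
  by rewrite invfM; ring.
rewrite -qchu mulr_sumr; apply: eq_bigr => k _.
rewrite [(k + s)%N]addnC qpochD.
have := qpoch_qV q0 qN1 (ltn_ord k : k <= m)%N.
set x := q ^- m => E.
have -> : u ^+ k = (q ^+ k) ^+ s * q ^+ k * x ^+ k.
  by rewrite /u !exprMn exprAC.
transitivity (kappa / qpoch q e s * (qpoch q x k / qpoch q q k)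
  * (qpoch q z k / qpoch q (e * q ^+ s) k) * ((q ^+ k) ^+ s * q ^+ k)).
  by field; rewrite !(ab_neq0, ac_neq0, ad_neq0, pq_neq0, e_neq0, es_neq0).
by rewrite E; ring.
Qed.

(** * Moments along the products w_j *)

Definition aw_moment (F : fieldType) (q a b c d : F) (j : nat) : F :=
  qpoch q (a * b) j * qpoch q (a * c) j * qpoch q (a * d) j
  / qpoch q (a * b * c * d) j.

Lemma askey_wilson_pairing (F : fieldType) (q a b c d : F)
    (L : {scalar {poly F}}) (f : {poly F}) m :
  L (f * askey_wilson q a b c d m) =
  (qpoch q (a * b) m * qpoch q (a * c) m * qpoch q (a * d) m / a ^+ m) *
  \sum_(k < m.+1)
    (qpoch q (q ^- m) k * qpoch q (a * b * c * d * q ^ (m%:Z - 1)) k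
     / (qpoch q q k * qpoch q (a * b) k * qpoch q (a * c) k * qpoch q (a * d) k)
     * q ^+ k) * L (f * awbase q a k).
Proof.
rewrite /askey_wilson -scalerAr linearZ /=; congr (_ * _).
rewrite mulr_sumr linear_sum; apply: eq_bigr => k _.
by rewrite -scalerAr linearZ.
Qed.

Lemma awbase0 (F : fieldType) (q a : F) : awbase q a 0 = 1.
Proof. by rewrite /awbase big_ord0. Qed.

Lemma awbaseS (F : fieldType) (q a : F) k :
  awbase q a k.+1
  = awbase q a k * (1 - (2 * (a * q ^+ k)) *: 'X + ((a * q ^+ k) ^+ 2)%:P).
Proof. by rewrite /awbase big_ord_recr. Qed.

Lemma askey_wilson0 (F : fieldType) (q a b c d : F) :
  askey_wilson q a b c d 0 = 1.
Proof.
rewrite /askey_wilson big_ord1 !qpoch0 awbase0 expr0.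
by rewrite !mulr1 invr1 mulr1 !scale1r.
Qed.

(** Orthogonality of the polynomial of index j to the one of index 0, which is
    1, determines L(w_j) from the L(w_i) with i < j, since the coefficient of w_j
    is nonzero. The claimed values solve the same equation:
    [askey_wilson_coef_sum] with s = 0 has the factor 1 - q^0. *)
Lemma moment_awbase (F : fieldType) (q a b c d : F) (L : {scalar {poly F}}) j :
  generic_parameters q a b c d ->
  orthogonality_functional (askey_wilson q a b c d) L ->
  L (awbase q a j) = aw_moment q a b c d j.
Proof.
move=> gen [L1 Lorth]; have [a0 q0 qN1 genN1] := gen.
have [k] := ubnP j; elim: k j => // k IHk [|j].
  by rewrite awbase0 L1 /aw_moment !qpoch0 !mul1r invr1.
rewrite ltnS => lt_jk.
have pq_neq0 i : qpoch q q i != 0 by apply: qpoch_qq_neq0.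
have ab_neq0 i : qpoch q (a * b) i != 0 by apply: qpoch_neq0 => l; case: (genN1 l).
have ac_neq0 i : qpoch q (a * c) i != 0 by apply: qpoch_neq0 => l; case: (genN1 l).
have ad_neq0 i : qpoch q (a * d) i != 0 by apply: qpoch_neq0 => l; case: (genN1 l).
have := Lorth 0%N j.+1 isT; rewrite askey_wilson0 askey_wilson_pairing.
move/eqP; rewrite mulf_eq0 !mulf_eq0 invr_eq0 expf_eq0 /= (negbTE a0).
rewrite !(negbTE (ab_neq0 _), negbTE (ac_neq0 _), negbTE (ad_neq0 _)) /=.
have := askey_wilson_coef_sum 1 0 j.+1 gen.
rewrite expr0 qpochSl subrr !mul0r mulr0 mul0r.
rewrite big_ord_recr [X in _ -> X == 0 -> _]big_ord_recr /=.
set S := \sum_(i < j.+1) _; set S' := \sum_(i < j.+1) _.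
have -> : S' = S.
  apply: eq_bigr => i _; rewrite mul1r IHk; last by have := ltn_ord i; lia.
  by rewrite /aw_moment expr0 !mul1r addn0.
set x := (X in X * _).
rewrite addn0 expr0 !mul1r => <- /eqP; move/addrI/mulfI => -> //.
rewrite /x mulf_eq0 negb_or expf_neq0 // andbT.
rewrite !mulf_eq0 invr_eq0 !mulf_eq0 !negb_or.
rewrite pq_neq0 ab_neq0 ac_neq0 ad_neq0 !andbT; apply/andP; split.
  apply/prodf_neq0 => i _; rewrite subr_eq0 eq_sym.
  have -> : q ^+ j.+1 = q ^+ (j - i).+1 * q ^+ i.
    by rewrite -exprD addSn subnK // -ltnS.
  by rewrite invfM -mulrA mulVf ?mulr1 ?expf_neq0 // invr_eq1.
have -> : j.+1%:Z - 1 = j%:Z by lia.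
apply: qpoch_neq0 => i; rewrite -mulrA -exprD.
by case: (genN1 (j + i)%N).
Qed.

(** With y = a q^j, w_(j+1) = w_j (1 - 2 y x + y^2), hence
    2x w_j = (1/y + y) w_j - w_(j+1) / y: the recurrence in the degree k trades
    multiplication by x for a shift of j. *)
Lemma ttr_moment (F : fieldType) (q a : F) (B C : nat -> F)
    (L : {scalar {poly F}}) (M : nat -> nat -> F) :
  a != 0 -> q != 0 ->
  (forall j, L (awbase q a j) = M 0%N j) ->
  (forall k j, M k.+1 j = ((a * q ^+ j)^-1 + a * q ^+ j - B k) * M k j
     - (a * q ^+ j)^-1 * M k j.+1 - C k * M k.-1 j) ->
  forall k j, L (ttr B C k * awbase q a j) = M k j.
Proof.
move=> a0 q0 M0 MS k; have [n] := ubnP k; elim: n k => // n IHn [|k] /=.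
  by move=> _ j; rewrite mul1r.
rewrite ltnS => lt_kn j; rewrite MS -!IHn ?(leq_ltn_trans (leq_pred _)) //.
set P := ttr B C k; set P' := ttr B C k.-1; set x := a * q ^+ j.
have x0 : x != 0 by rewrite mulf_neq0 ?expf_neq0.
have -> : ((2 *: 'X - (B k)%:P) * P - C k *: P') * awbase q a j
    = (x^-1 + x - B k) *: (P * awbase q a j)
      - x^-1 *: (P * awbase q a j.+1) - C k *: (P' * awbase q a j).
  rewrite awbaseS -/x; clearbody x; have xV : x^-1%:P * x%:P = 1 by rewrite -polyCM mulVf.
  rewrite -!mul_polyC !(polyCM, polyCB, polyCD, polyC_exp, polyC1).
  move: (awbase q a j) xV; set y := x^-1%:P => w xV.
  transitivity ((y * x%:P) * (2 * 'X) * P * w - (y * x%:P) * x%:P * P * w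
     + x%:P * P * w - (B k)%:P * P * w - (C k)%:P * P' * w);
    first by rewrite !xV; ring.
  by ring.
by rewrite !linearB /= !linearZ.
Qed.

(** Up to the factor L(w_j), the functional f |-> L(f w_j) has a q^j in place
    of a, so the content is that L(D_k(b,c,d)) is a^k (bc, bd, cd)_k / (abcd)_k. *)
Lemma moment_dqh_omit (F : fieldType) (q a b c d : F) (L : {scalar {poly F}}) k j :
  generic_parameters q a b c d ->
  (forall j, L (awbase q a j) = aw_moment q a b c d j) ->
  L (dqh q b c d k * awbase q a j)
  = a ^+ k * (qpoch q (b * c) k * qpoch q (b * d) k * qpoch q (c * d) k)
    * (q ^+ j) ^+ k
    * (qpoch q (a * b) j * qpoch q (a * c) j * qpoch q (a * d) j)
    / qpoch q (a * b * c * d) (j + k).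
Proof.
case=> a0 q0 qN1 genN1 Lw.
set e := a * b * c * d.
have e1 i : 1 - e * q ^+ i != 0 by rewrite subr_eq0 eq_sym; case: (genN1 i).
have e_neq0 i : qpoch q e i != 0 by apply: qpoch_neq0 => l; case: (genN1 l).
pose M k j := a ^+ k * (qpoch q (b * c) k * qpoch q (b * d) k * qpoch q (c * d) k)
    * (q ^+ j) ^+ k
    * (qpoch q (a * b) j * qpoch q (a * c) j * qpoch q (a * d) j)
    / qpoch q e (j + k).
apply: (ttr_moment (M := M)) => // {j}[j|{}k j].
  by rewrite Lw /aw_moment /M !qpoch0 addn0 !mul1r.
set Ck := (X in _ - X * M k.-1 j).
have -> : Ck * M k.-1 j
    = (1 - q ^+ k) * (1 - e * (q ^+ j * q ^+ k / q)) / (a * q ^+ j) * M k j.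
  rewrite /Ck; case: k {Ck} => [|k]; first by rewrite expr0 subrr !mul0r.
  rewrite /M /= addnS !qpochS !exprS exprD.
  by field; rewrite -exprD e1 e_neq0 a0 q0 expf_neq0.
have -> : M k j.+1 = q ^+ k * ((1 - a * b * q ^+ j) * (1 - a * c * q ^+ j)
    * (1 - a * d * q ^+ j)) / (1 - e * (q ^+ j * q ^+ k)) * M k j.
  rewrite /M addSn !qpochS exprSr exprMn exprD.
  by field; rewrite -exprD e1 e_neq0.
have -> : M k.+1 j = a * ((1 - b * c * q ^+ k) * (1 - b * d * q ^+ k)
    * (1 - c * d * q ^+ k)) * q ^+ j / (1 - e * (q ^+ j * q ^+ k)) * M k j.
  rewrite /M addnS !qpochS !exprS exprD.
  by field; rewrite -exprD e1 e_neq0.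
have := e1 (j + k)%N; rewrite exprD /e => {}e1; field.
by rewrite a0 q0 expf_neq0 // e1.
Qed.

(** The product over i < k vanishes for j < k: this is the orthogonality of
    D_k to the polynomials of degree less than k. *)
Lemma moment_dqh_full (F : fieldType) (q a b c : F) (L : {scalar {poly F}}) k j :
  generic_parameters q a b c 0 ->
  (forall j, L (awbase q a j) = aw_moment q a b c 0 j) ->
  L (dqh q a b c k * awbase q a j)
  = a ^+ k * qpoch q (b * c) k * (qpoch q (a * b) j * qpoch q (a * c) j)
    * \prod_(i < k) (q ^+ j - q ^+ i).
Proof.
case=> a0 q0 qN1 genN1 Lw.
pose M k j := a ^+ k * qpoch q (b * c) k
    * (qpoch q (a * b) j * qpoch q (a * c) j) * \prod_(i < k) (q ^+ j - q ^+ i).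
apply: (ttr_moment (M := M)) => // {j}[j|{}k j].
  by rewrite Lw /aw_moment /M !mulr0 !qpoch_z0 qpoch0 big_ord0 invr1 !(mulr1, mul1r).
(* q^(j+1) - q^(i+1) = q (q^j - q^i), and the factor i = 0 stays apart *)
have shift_prod l : \prod_(i < l.+1) (q ^+ j.+1 - q ^+ i)
    = q ^+ l.+1 * (q ^+ j - q^-1) * \prod_(i < l) (q ^+ j - q ^+ i).
  rewrite big_ord_recl /=.
  under eq_bigr => i _ do rewrite /bump add1n !exprS -mulrBr.
  rewrite big_split /= prodr_const card_ord exprS.
  by rewrite expr0 !exprS; field.
case: k => [|k]; rewrite /M.
  rewrite !big_ord_recr !big_ord0 /= !qpochS !qpoch0 !expr0 !mul1r subrr !mul0r.
  by rewrite subr0; field; rewrite a0 q0 expf_neq0.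
rewrite shift_prod !big_ord_recr /= !qpochS !exprS.
by field; rewrite a0 q0 expf_neq0.
Qed.

(** * Pairings with the orthogonal polynomials *)

Lemma qpoch_falling_eq0 (F : fieldType) (q : F) s m : q != 0 ->
  (s < m)%N -> qpoch q^-1 (q ^+ s) m = 0.
Proof.
move=> q0 lt_sm; rewrite /qpoch (bigD1 (Ordinal lt_sm)) //=.
by rewrite exprVn mulfV ?expf_neq0 // subrr mul0r.
Qed.

Lemma qpoch_falling_diag (F : fieldType) (q : F) m : q != 0 ->
  qpoch q^-1 (q ^+ m) m = qpoch q q m.
Proof.
move=> q0; rewrite -qpoch_falling // mulrAC mulfV ?expf_neq0 //.
by rewrite mul1r.
Qed.

(** The sum is a linear functional of the polynomial with roots q^i, i < k,
    read at the points q^j. Its value on the s-th power is (q^s; 1/q)_m, so it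
    kills degrees below m and sends a monic polynomial of degree m to (q)_m; for
    k > m each q^j is a root. *)
Lemma qdifference_newton (F : fieldType) (q : F) (m k : nat) (q0 : q != 0)
    (qN1 : forall k, q ^+ k.+1 != 1) :
  \sum_(j < m.+1) qpoch q (q ^- m) j / qpoch q q j * q ^+ j
     * \prod_(i < k) (q ^+ j - q ^+ i)
  = if k == m then qpoch q q m else 0.
Proof.
have [lt_mk|le_km] := ltnP m k.
  rewrite (gtn_eqF lt_mk) big1 // => j _.
  have lt_jk : (j < k)%N by apply: leq_ltn_trans lt_mk; rewrite -ltnS.
  by rewrite (bigD1 (Ordinal lt_jk)) //= subrr mul0r mulr0.
pose p : {poly F} := \prod_(x <- [seq q ^+ val i | i : 'I_k]) ('X - x%:P).
have sz_p : size p = k.+1 by rewrite size_prod_XsubC size_map size_enum_ord.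
have pE j : \prod_(i < k) (q ^+ j - q ^+ i) = p.[q ^+ j].
  by rewrite /p big_map horner_prod big_enum /=; apply: eq_bigr => i _; rewrite !hornerE.
(* with b = c = d = 0 all shifted factorials but (q^-m)_j and (q)_j are 1 *)
have gen0 : generic_parameters q 1 0 0 0.
  by split=> // [|i]; rewrite ?oner_neq0 // !(mulr0, mul0r) eq_sym oner_neq0.
have power_sum s : \sum_(j < m.+1) qpoch q (q ^- m) j / qpoch q q j * q ^+ j
    * (q ^+ j) ^+ s = qpoch q^-1 (q ^+ s) m.
  have := askey_wilson_coef_sum 1 s m gen0.
  rewrite !(mulr0, mul0r) !qpoch_z0 mulr1 invr1 mulr1 mul1r => <-.
  by apply: eq_bigr => j _; rewrite !qpoch_z0 !(mul1r, mulr1) invr1 mulr1.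
under eq_bigr => j _ do rewrite pE horner_coef sz_p mulr_sumr.
rewrite exchange_big /=.
under eq_bigr => s _ do
  (under eq_bigr => j _ do rewrite mulrCA; rewrite -mulr_sumr power_sum).
case: eqVneq => [eq_km|neq_km]; first subst m.
  rewrite big_ord_recr /= big1 => [|s _]; last first.
    by rewrite qpoch_falling_eq0 // mulr0.
  have : lead_coef p = 1 by apply/eqP/monic_prod_XsubC.
  by rewrite lead_coefE sz_p /= => ->; rewrite mul1r add0r qpoch_falling_diag.
rewrite big1 // => s _; rewrite qpoch_falling_eq0 ?mulr0 //.
by have := ltn_ord s; lia.
Qed.

Lemma linear_monomial_dqh (F : fieldType) (q a b c : F) (L : {scalar {poly F}})
    (p : {poly F}) n :
  2 != 0 :> F -> q != 0 -> (forall k, q ^+ k.+1 != 1) ->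
  L ('X^n * p)
  = 1 / 2 ^+ n * \sum_(k < n.+1) dqh_coef q a b c n k * L (dqh q a b c k * p).
Proof.
move=> two0 q0 qN1; have := monomial_dqh a b c q0 qN1 n.
move/(congr1 (fun r => L (r * p))); rewrite -scalerAl linearZ mulr_suml linear_sum.
under eq_bigr => k _ do rewrite -scalerAl linearZ /=.
move=> <-; rewrite mul1r mulrA mulVf ?mul1r //.
by rewrite expf_neq0.
Qed.

Lemma dual_qhahn_pairing (F : fieldType) (q a b c : F) (L : {scalar {poly F}})
    k m :
  generic_parameters q a b c 0 ->
  orthogonality_functional (dual_qhahn q a b c) L ->
  L (dqh q a b c k * dual_qhahn q a b c m)
  = if k == m then qpoch q q m * qpoch q (a * b) m * qpoch q (a * c) m
                   * qpoch q (b * c) m else 0.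
Proof.
move=> gen hL; have [a0 q0 qN1 genN1] := gen.
have ab_neq0 i : qpoch q (a * b) i != 0 by apply: qpoch_neq0 => l; case: (genN1 l).
have ac_neq0 i : qpoch q (a * c) i != 0 by apply: qpoch_neq0 => l; case: (genN1 l).
have pq_neq0 j : qpoch q q j != 0 by apply: qpoch_qq_neq0.
have Lw j := moment_awbase j gen hL.
rewrite /dual_qhahn askey_wilson_pairing !(mulr0, mul0r) !qpoch_z0 mulr1.
under eq_bigr => j _ do rewrite (moment_dqh_full _ _ gen Lw) !qpoch_z0 !mulr1.
transitivity (qpoch q (a * b) m * qpoch q (a * c) m / a ^+ m
  * (a ^+ k * qpoch q (b * c) k) * \sum_(j < m.+1) qpoch q (q ^- m) j
     / qpoch q q j * q ^+ j * \prod_(i < k) (q ^+ j - q ^+ i)).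
  rewrite -[RHS]mulrA; congr (_ * _); rewrite mulr_sumr; apply: eq_bigr => j _.
  by field; rewrite !(ab_neq0, ac_neq0, pq_neq0).
rewrite qdifference_newton //; case: eqVneq => [->|_]; last by rewrite mulr0.
by field; rewrite expf_neq0.
Qed.

(** * The moment formulas *)

Lemma dual_qhahn_moment (F : fieldType) (q a b c : F) (L : {scalar {poly F}})
    n m :
  2 != 0 :> F -> generic_parameters q a b c 0 ->
  orthogonality_functional (dual_qhahn q a b c) L ->
  L ('X^n * dual_qhahn q a b c m)
  = qpoch q q m * qpoch q (a * c) m * qpoch q (b * c) m / 2 ^+ n
    * \sum_(alpha < n.+1) \sum_(beta < n.+1) \sum_(gamma < n.+1)
        Pbar q n (alpha + beta + gamma + m)
        * qmultinom q [:: val alpha; val beta; val gamma; m]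
        * a ^+ alpha * b ^+ beta * c ^+ gamma
        * qpoch q (a * b) (gamma + m).
Proof.
move=> two0 gen hL; have [a0 q0 qN1 _] := gen.
rewrite (linear_monomial_dqh a b c _ _ _ two0 q0 qN1).
under eq_bigr => k _ do rewrite dual_qhahn_pairing //.
transitivity (1 / 2 ^+ n * (dqh_coef q a b c n m * (qpoch q q m
    * qpoch q (a * b) m * qpoch q (a * c) m * qpoch q (b * c) m))).
  congr (_ * _); have [lt_mn|le_nm] := ltnP m n.+1.
    rewrite (bigD1 (Ordinal lt_mn)) //= eqxx big1 ?addr0 // => k neq_km.
    by rewrite -val_eqE /= in neq_km; rewrite (negbTE neq_km) mulr0.
  rewrite /dqh_coef big1 => [|k _]; last first.
    by rewrite ltn_eqF ?mulr0 // (leq_trans (ltn_ord k)).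
  rewrite big1 ?mul0r // => i _; rewrite big1 // => j _; rewrite big1 // => k _.
  by rewrite Pbar_eq0 ?mul0r //; lia.
rewrite /dqh_coef mulr_suml !mulr_sumr; apply: eq_bigr => i _.
rewrite mulr_suml !mulr_sumr; apply: eq_bigr => j _.
rewrite mulr_suml !mulr_sumr; apply: eq_bigr => k _.
by rewrite [(k + m)%N]addnC qpochD mul1r; ring.
Qed.

(** The index of D_k(b,c,d) in the expansion of the monomial becomes the
    exponent alpha of a. *)
Lemma askey_wilson_moment (F : fieldType) (q a b c d : F) (L : {scalar {poly F}})
    n m :
  2 != 0 :> F -> generic_parameters q a b c d ->
  orthogonality_functional (askey_wilson q a b c d) L ->
  L ('X^n * askey_wilson q a b c d m)
      = 1 / 2 ^+ n
        * \sum_(alpha < n.+1) \sum_(beta < n.+1)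
          \sum_(gamma < n.+1) \sum_(delta < n.+1)
            a ^+ alpha * b ^+ beta * c ^+ gamma * d ^+ delta
            * Pbar q n (alpha + beta + gamma + delta)
            * qmultinom q [:: val alpha; val beta; val gamma; val delta]
            * (qpoch q (b * d) alpha * qpoch q (c * d) alpha
               * qpoch q (b * c) (alpha + delta)
               / qpoch q (a * b * c * d) alpha)
            * (qpoch q (a * b) m * qpoch q (a * c) m * qpoch q (a * d) m
               * qpoch q^-1 (q ^+ alpha) m
               / (a ^+ m * qpoch q (a * b * c * d * q ^+ alpha) m)).
Proof.
move=> two0 gen hL; have [a0 q0 qN1 genN1] := gen.
have pq_neq0 j : qpoch q q j != 0 by apply: qpoch_qq_neq0.
have e_neq0 i : qpoch q (a * b * c * d) i != 0.
  by apply: qpoch_neq0 => l; case: (genN1 l).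
rewrite (linear_monomial_dqh b c d _ _ _ two0 q0 qN1); congr (_ * _); apply: eq_bigr => k _.
rewrite askey_wilson_pairing.
under eq_bigr => j _ do rewrite (moment_dqh_omit _ _ gen (fun i => moment_awbase i gen hL)).
rewrite askey_wilson_coef_sum // /dqh_coef mulr_suml.
apply: eq_bigr => beta _; rewrite mulr_suml.
apply: eq_bigr => gamma _; rewrite mulr_suml.
apply: eq_bigr => delta _.
rewrite !qmultinom4E [qpoch q (b * c) (k + delta)]qpochD /=.
have -> : (beta + gamma + delta + k)%N = (k + beta + gamma + delta)%N by lia.
have -> : (beta + (gamma + (delta + k)))%N = (k + (beta + (gamma + delta)))%N by lia.
have ek_neq0 : qpoch q (a * b * c * d * q ^+ k) m != 0.
  by apply: qpoch_neq0 => l; rewrite -mulrA -exprD; case: (genN1 (k + l)%N).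
by field; rewrite !(pq_neq0, e_neq0, ek_neq0) expf_neq0.
Qed.

Theorem theorem2p4 (F : fieldType) (charF0 : [pchar F] =i pred0)
  (q a b c d : F) (generic : generic_parameters q a b c d)
  (La Lab Labc Labcd : {scalar {poly F}})
  (hLa : orthogonality_functional (big_qhermite q a) La)
  (hLab : orthogonality_functional (al_salam_chihara q a b) Lab)
  (hLabc : orthogonality_functional (dual_qhahn q a b c) Labc)
  (hLabcd : orthogonality_functional (askey_wilson q a b c d) Labcd)
  (n m : nat) :
  [/\ La ('X^n * big_qhermite q a m)
      = qpoch q q m / 2 ^+ n
        * \sum_(alpha < n.+1)
            Pbar q n (alpha + m) * qbinom q (alpha + m) m * a ^+ alpha,
      Lab ('X^n * al_salam_chihara q a b m)
      = qpoch q q m * qpoch q (a * b) m / 2 ^+ n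
        * \sum_(alpha < n.+1) \sum_(beta < n.+1)
            Pbar q n (alpha + beta + m)
            * qmultinom q [:: val alpha; val beta; m]
            * a ^+ alpha * b ^+ beta,
      Labc ('X^n * dual_qhahn q a b c m)
      = qpoch q q m * qpoch q (a * c) m * qpoch q (b * c) m / 2 ^+ n
        * \sum_(alpha < n.+1) \sum_(beta < n.+1) \sum_(gamma < n.+1)
            Pbar q n (alpha + beta + gamma + m)
            * qmultinom q [:: val alpha; val beta; val gamma; m]
            * a ^+ alpha * b ^+ beta * c ^+ gamma
            * qpoch q (a * b) (gamma + m)
    & Labcd ('X^n * askey_wilson q a b c d m)
      = 1 / 2 ^+ n
        * \sum_(alpha < n.+1) \sum_(beta < n.+1)
          \sum_(gamma < n.+1) \sum_(delta < n.+1)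
            a ^+ alpha * b ^+ beta * c ^+ gamma * d ^+ delta
            * Pbar q n (alpha + beta + gamma + delta)
            * qmultinom q [:: val alpha; val beta; val gamma; val delta]
            * (qpoch q (b * d) alpha * qpoch q (c * d) alpha
               * qpoch q (b * c) (alpha + delta)
               / qpoch q (a * b * c * d) alpha)
            * (qpoch q (a * b) m * qpoch q (a * c) m * qpoch q (a * d) m
               * qpoch q^-1 (q ^+ alpha) m
               / (a ^+ m * qpoch q (a * b * c * d * q ^+ alpha) m))].
Proof.
have two0 : 2 != 0 :> F by have := charF0 2; rewrite inE /= => /negbT.
have gen4 := generic; case: generic => a0 q0 qN1 genN1.
(* the formulas with fewer parameters are the one for a, b, c at c = 0 *)
have gen3 b' c' : b' \in [:: b; 0] -> c' \in [:: c; 0] ->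
    generic_parameters q a b' c' 0.
  rewrite !inE => /orP[] /eqP -> /orP[] /eqP -> ; split=> // k;
    rewrite !(mulr0, mul0r) ![0 == _]eq_sym oner_neq0; case: (genN1 k) => *; split=> //.
have pq_neq0 j : qpoch q q j != 0 by apply: qpoch_qq_neq0.
have drop_zero (f : nat -> F) : \sum_(i < n.+1) f i * 0 ^+ i = f 0%N.
  rewrite big_ord_recl expr0 mulr1 big1 ?addr0 // => i _.
  by rewrite expr0n mulr0.
split.
- rewrite (dual_qhahn_moment (b := 0) (c := 0) _ _ two0 _ hLa); last first.
    by apply: gen3; rewrite !inE eqxx orbT.
  rewrite !(mulr0, mul0r) !qpoch_z0 !mulr1; congr (_ * _); apply: eq_bigr => i _.
  under eq_bigr => j _ do (under eq_bigr => k _ do rewrite qpoch_z0 mulr1).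
  under eq_bigr => j _ do rewrite (drop_zero (fun k => Pbar q n (i + j + k + m)
    * qmultinom q [:: val i; val j; k; m] * a ^+ i * 0 ^+ j)).
  rewrite (drop_zero (fun j => Pbar q n (i + j + 0 + m)
    * qmultinom q [:: val i; j; 0%N; m] * a ^+ i)).
  rewrite qmultinom4E !qpoch0 !mulr1 !addn0 add0n qbinomDl.
  by rewrite [_ i * _ m]mulrC.
- rewrite (dual_qhahn_moment (c := 0) _ _ two0 _ hLab); last first.
    by apply: gen3; rewrite !inE eqxx ?orbT.
  rewrite !(mulr0, mul0r) !qpoch_z0 !mulr1.
  rewrite [qpoch q q m * _ / _]mulrAC -[RHS]mulrA; congr (_ * _).
  rewrite mulr_sumr; apply: eq_bigr => i _.
  rewrite mulr_sumr; apply: eq_bigr => j _.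
  under eq_bigr => k _ do rewrite mulrAC.
  rewrite (drop_zero (fun k => Pbar q n (i + j + k + m)
    * qmultinom q [:: val i; val j; k; m] * a ^+ i * b ^+ j
    * qpoch q (a * b) (k + m))).
  rewrite qmultinom4E /qmultinom /= !big_cons big_nil qpoch0 !addn0 !add0n.
  by field; rewrite !pq_neq0.
- by apply: dual_qhahn_moment => //; apply: gen3; rewrite !inE eqxx.
exact: askey_wilson_moment two0 gen4 hLabcd.
Qed.
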